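(* Let $\Omega\subset\mathbb{R}^n$ be a bounded domain, $S_1,S_2\subset\Omega$, and $\vec F\in C^{1}(\Omega)\cap C^0(\bar\Omega)$ a vector field. Let $u\in C^0(\bar\Omega\setminus S_1)$, $v\in C^0(\bar\Omega\setminus S_2)$, let $S(u,\vec F)$ (resp. $S(v,\vec F)$) be the set of points of $\Omega\setminus S_1$ (resp. $\Omega\setminus S_2$) where $\nabla u+\vec F=0$ (resp. $\nabla v+\vec F=0$), and let $S_{\vec F}=S_1\cup S_2\cup S(u,\vec F)\cup S(v,\vec F)$. Assume $u,v\in C^2(\Omega\setminus S_{\vec F})$ and $\mathcal{H}_{n-1}(\bar S_{\vec F})=0$, where $\mathcal{H}_{n-1}$ is the $(n-1)$-dimensional Hausdorff measure. Suppose $$\operatorname{div}\Big(\frac{\nabla u+\vec F}{|\nabla u+\vec F|}\Big)\ge\operatorname{div}\Big(\frac{\nabla v+\vec F}{|\nabla v+\vec F|}\Big)\ \text{ in }\Omega\setminus S_{\vec F},\qquad u\le v\ \text{ on }\partial\Omega\setminus S_{\vec F}.$$ Then $\frac{\nabla u+\vec F}{|\nabla u+\vec F|}=\frac{\nabla v+\vec F}{|\nabla v+\vec F|}$ in $\Omega^+\setminus S_{\vec F}$, where $\Omega^+=\{p\in\Omega:u(p)-v(p)>0\}$. *)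

(* Defs.v *)
From HB Require Import structures.
From mathcomp Require Import all_boot all_order all_algebra.
From mathcomp Require Import all_classical all_reals all_analysis.
Set Implicit Arguments. Unset Strict Implicit. Unset Printing Implicit Defensive.
Import Order.TTheory GRing.Theory Num.Theory.
Import numFieldNormedType.Exports.
Local Open Scope classical_set_scope.
Local Open Scope ring_scope.

Section Defs.
Variables (R : realType) (n : nat).
Local Notation V := 'rV[R]_n.

Definition basis_vec (i : 'I_n) : V := delta_mx 0 i.

(* Euclidean norm on R^n (the library's norm on 'rV is the sup norm) *)
Definition eucl_norm (w : V) : R := Num.sqrt (\sum_(i < n) (w 0 i) ^+ 2).

Definition partial (f : V -> R) (i : 'I_n) (x : V) : R := 'D_(basis_vec i) f x.

Definition grad (f : V -> R) (x : V) : V := \row_(i < n) partial f i x.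

Definition divergence (W : V -> V) (x : V) : R :=
  \sum_(i < n) partial (fun y => W y 0 i) i x.

Definition C1on (A : set V) (f : V -> R) : Prop :=
  forall i : 'I_n, (forall x, A x -> derivable f x (basis_vec i)) /\
                   {within A, continuous (partial f i)}.

Definition C2on (A : set V) (f : V -> R) : Prop :=
  C1on A f /\ forall i : 'I_n, C1on A (partial f i).

Definition C1field (A : set V) (F : V -> V) : Prop :=
  forall j : 'I_n, C1on A (fun x => F x 0 j).

Definition crit_set (Omega S : set V) (u : V -> R) (F : V -> V) : set V :=
  [set p | (Omega `\` S) p /\ (forall i, derivable u p (basis_vec i)) /\
           grad u p + F p = 0].

Definition normalized_field (u : V -> R) (F : V -> V) (x : V) : V :=
  (eucl_norm (grad u x + F x))^-1 *: (grad u x + F x).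

Local Open Scope ereal_scope.

Definition diam (C : set V) : \bar R :=
  ereal_sup [set (eucl_norm (x - y))%:E | x in C & y in C].

Definition hcost (s : nat) (C : set V) : \bar R :=
  if pselect (C = set0) then 0 else ((fine (diam C)) ^+ s)%R%:E.

Definition hausdorff_content (s : nat) (delta : R) (A : set V) : \bar R :=
  ereal_inf [set \sum_(0 <= k <oo) hcost s (Cs k) |
               Cs in [set Cs : nat -> set V |
                        A `<=` \bigcup_k Cs k /\
                        forall k, diam (Cs k) <= delta%:E]].

(* s-dimensional Hausdorff measure H^s(A) = sup_{delta > 0} H^s_delta(A)
   (unnormalized: the normalizing constant is irrelevant here) *)
Definition hausdorff_measure (s : nat) (A : set V) : \bar R :=
  ereal_sup [set hausdorff_content s delta A | delta in [set d : R | (0 < d)%R]].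

End Defs.

(* Main.v *)
(** Fix [eps > 0], let [N(u)] be the normalized field of [u], and let [g] be a
    bounded C1 function vanishing on [(-oo, eps]] and strictly increasing beyond.
    Off the compact null set [K = closure SF], the field
    [X = g(u - v) (N(u) - N(v))], extended by 0, is C1, bounded and vanishes
    outside [Omega] (near the boundary, [u - v < eps]).  Off [K] in [Omega],
      [div X >= g'(u - v) (grad u - grad v).(N(u) - N(v)) >= 0],
    and the last inequality is strict where [u - v > eps] and [N(u) <> N(v)].
    But [div X] has integral 0: the flux through the boundary of a union of small
    cubes covering [K] is at most a constant times their total area, which is
    arbitrarily small.  Instead of integrals we use sums over a fine grid of a
    large periodic box, where the divergence theorem is summation by parts.
    Points of [K] outside [SF] are reached by continuity, since [K] has empty
    interior. *)

Require Import Defs.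
From HB Require Import structures.
From mathcomp Require Import all_boot all_order all_algebra.
From mathcomp Require Import all_classical all_reals all_analysis.
From mathcomp Require Import ring lra.
Import Order.TTheory GRing.Theory Num.Theory.
Import numFieldNormedType.Exports.
Local Open Scope classical_set_scope.
Local Open Scope ring_scope.
Set Implicit Arguments. Unset Strict Implicit. Unset Printing Implicit Defensive.

(** * Functions that are C1 in one direction *)

Lemma cvg_sum_ord (R : realType) m T (F : set_system T) (f : 'I_m -> T -> R)
    (l : 'I_m -> R) : Filter F ->
  (forall i, f i x @[x --> F] --> l i) ->
  \sum_(i < m) f i x @[x --> F] --> \sum_(i < m) l i.
Proof. by move=> FF fl; apply: cvg_big => //; exact: add_continuous. Qed.

Section DirectionalC1.
Context {R : realType} {n : nat}.
Local Notation V := 'rV[R]_n.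
Implicit Types (e x q : V) (f g d : V -> R).

(** Lets the chain rule and the mean value theorem of one real variable serve for directional
    derivatives. *)
Lemma is_derive_lineP e x f (t df : R) :
  is_derive (t *: e + x) e f df <-> is_derive t 1 (fun s => f (s *: e + x)) df.
Proof.
have E : (fun h => h^-1 *: ((f \o shift (t *: e + x)) (h *: e) - f (t *: e + x)))
  = (fun h => h^-1 *: (((fun s => f (s *: e + x)) \o shift t) (h *: (1 : R)) -
                        f (t *: e + x))).
  by apply/funext => h /=; rewrite scalerDl addrA -scalerA scale1r.
by split=> -[h1 h2]; split; move: h1 h2; rewrite /derivable /derive E.
Qed.

Lemma is_derive_comp e x f (g : R -> R) (df dg : R) :
  is_derive x e f df -> is_derive (f x) 1 g dg ->
  is_derive x e (g \o f) (dg * df).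
Proof.
move=> fx gx; have x0 : x = 0 *: e + x by rewrite scale0r add0r.
rewrite x0 in fx gx *; apply/is_derive_lineP.
apply: (@is_derive1_comp R g (fun s => f (s *: e + x))) => //.
exact/is_derive_lineP.
Qed.

(** Continuity of [f] is a separate clause, since a derivative along the single direction [e] does
    not control [f] across the other directions. The derivative has to exist near [q] but to be
    continuous only at [q]. *)
Definition C1at e f q := {for q, continuous f} /\
  exists2 d : V -> R, (\forall x \near q, is_derive x e f (d x)) &
                      {for q, continuous d}.

Lemma C1at_cst e (c : R) q : C1at e (cst c) q.
Proof.
split; first exact: (@cst_continuous V R c q).
by exists (cst 0); [near=> x; exact: is_derive_cst | exact: (@cst_continuous V R 0 q)].
Unshelve. all: by end_near. Qed.

Lemma C1atD e f g q : C1at e f q -> C1at e g q -> C1at e (fun x => f x + g x) q.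
Proof.
move=> [cf [df Df cdf]] [cg [dg Dg cdg]]; split; first exact: (cvgD cf cg).
exists (fun x => df x + dg x); last exact: (cvgD cdf cdg).
near=> x.
have ? : is_derive x e f (df x) by near: x.
have ? : is_derive x e g (dg x) by near: x.
exact: is_deriveD.
Unshelve. all: by end_near. Qed.

Lemma C1atM e f g q : C1at e f q -> C1at e g q -> C1at e (fun x => f x * g x) q.
Proof.
move=> [cf [df Df cdf]] [cg [dg Dg cdg]]; split; first exact: (cvgM cf cg).
exists (fun x => f x * dg x + g x * df x); last exact: (cvgD (cvgM cf cdg) (cvgM cg cdf)).
near=> x.
have ? : is_derive x e f (df x) by near: x.
have ? : is_derive x e g (dg x) by near: x.
exact: is_deriveM.
Unshelve. all: by end_near. Qed.

Lemma C1atB e f g q : C1at e f q -> C1at e g q -> C1at e (fun x => f x - g x) q.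
Proof.
move=> Cf Cg; have := C1atD Cf (C1atM (C1at_cst e (-1) q) Cg).
by under eq_fun do rewrite /cst mulN1r.
Qed.

Lemma C1at_sum e m (f : 'I_m -> V -> R) q :
  (forall i, C1at e (f i) q) -> C1at e (fun x => \sum_(i < m) f i x) q.
Proof.
elim: m f => [|m IH] f Cf.
  under eq_fun do rewrite big_ord0.
  exact: C1at_cst.
under eq_fun do rewrite big_ord_recl.
by apply: C1atD => //; exact: IH.
Qed.

Lemma C1at_comp e f (g dg : R -> R) q : C1at e f q ->
  (\forall y \near f q, is_derive (y : R) (1 : R) g (dg y)) -> {for f q, continuous dg} ->
  C1at e (g \o f) q.
Proof.
move=> [cf [df Df cdf]] Dg cdg; split.
  apply: continuous_comp => //.
  have [? _] := nbhs_singleton Dg.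
  exact/differentiable_continuous/derivable1_diffP.
exists (fun x => dg (f x) * df x).
  have cf' := cf _ Dg.
  near=> x; apply: is_derive_comp; near: x => //.
exact: (cvgM (continuous_comp cf cdg) cdf).
Unshelve. all: by end_near. Qed.

Lemma near_eq_C1at e f g q :
  (\forall x \near q, f x = g x) -> C1at e f q -> C1at e g q.
Proof.
move=> fg [cf [d Df cd]]; split.
  have := cvg_trans (near_eq_cvg fg) cf.
  by rewrite (nbhs_singleton fg); exact.
exists d => //.
have fg' := near_join fg.
near=> x; have ? : is_derive x e f (d x) by near: x.
by apply: near_eq_is_derive; near: x.
Unshelve. all: by end_near. Qed.

Lemma C1at_derive e f q : C1at e f q ->
  (\forall x \near q, derivable f x e) /\ {for q, continuous ('D_e f)}.
Proof.
move=> [cf [d Df cd]]; split.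
  by apply: filterS Df => x [].
have E : \forall x \near q, d x = 'D_e f x by apply: filterS Df => x [].
have := cvg_trans (near_eq_cvg E) cd.
by rewrite (nbhs_singleton E); exact.
Qed.

(** By the mean value theorem the difference quotient is a derivative at a point of the segment, and
    near [q] all these derivatives are within [eps / 2] of the one at [q]. Joint uniformity in [x]
    and [h] is the form that a compactness argument can globalize. *)
Lemma C1at_increment e f q (eps : R) : 0 < eps -> C1at e f q ->
  \forall x \near q & h \near 0^'+,
    `|f (h *: e + x) - f x - h * 'D_e f x| <= h * eps.
Proof.
move=> eps0 /C1at_derive[Df cD].
have e2 : 0 < eps / 2 by rewrite divr_gt0.
move/cvgrPdist_lt: cD => /(_ _ e2) cD.
have : \forall x \near q, derivable f x e /\ `|'D_e f q - 'D_e f x| < eps / 2.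
  exact: filterI.
move=> /nbhs_ballP[r /= r0 rP].
have r2 : 0 < r / 2 by rewrite divr_gt0.
have e1 : 0 < `|e| + 1 by rewrite ltr_wpDl.
(* With [x] within [r / 2] of [q] and [h *: e] shorter than [r / 2], the whole segment stays in
   [ball q r]. The [+ 1] covers [e = 0]. *)
exists (ball q (r / 2), [set h | 0 < h /\ h < r / 2 / (`|e| + 1)]) => /=.
  split; first exact: nbhsx_ballx.
  near=> h; split; near: h; first exact: nbhs_right_gt.
  by apply: nbhs_right_lt; rewrite divr_gt0.
move=> [x h] /= [qx [h0 hr]].
have inball s : 0 <= s <= h -> ball q r (s *: e + x).
  move=> /andP[s0 sh]; rewrite -ball_normE /ball_ /= opprD addrCA.
  rewrite (le_lt_trans (ler_normD _ _))//.
  rewrite normrN normrZ ger0_norm// [ltRHS]splitr ler_ltD//; last first.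
    by move: qx; rewrite -ball_normE.
  rewrite (le_trans (ler_wpM2r _ sh))//.
  move: hr; rewrite ltr_pdivlMr// => hr.
  by rewrite (le_trans _ (ltW hr))// ler_wpM2l ?(ltW h0)// lerDl.
have dl s : 0 <= s <= h ->
    is_derive s 1 (fun s => f (s *: e + x)) ('D_e f (s *: e + x)).
  by move=> sh; apply/is_derive_lineP; have [? _] := rP _ (inball _ sh); split.
have [|||s sh] := @MVT_segment R (fun s => f (s *: e + x))
    (fun s => 'D_e f (s *: e + x)) 0 h.
- exact: ltW.
- by move=> s; rewrite in_itv/= => /andP[s0 sh]; apply: dl; rewrite !ltW.
- apply: derivable_within_continuous => s; rewrite in_itv/= => sh.
  by have [] := dl _ sh.
rewrite subr0 scale0r add0r => ->.
rewrite [_ * h]mulrC -mulrBr normrM gtr0_norm// ler_wpM2l ?ltW//.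
have h00 : 0 <= (0 : R) <= h by rewrite lexx ltW.
have [_ A] := rP _ (inball s sh); have [_ B] := rP _ (inball 0 h00).
rewrite scale0r add0r in B.
rewrite distrC -[X in `|X|](subrKA ('D_e f q)) (le_lt_trans (ler_normD _ _))//.
by rewrite (splitr eps) ltrD// distrC.
Unshelve. all: by end_near. Qed.

End DirectionalC1.
(** * Counting grid points *)

Section LineGrid.
Context {R : realType} {L : nat}.
Implicit Types (M h c r : R) (t : 'I_L.+2).

Lemma val_ordS t : (t + 1 : 'I_L.+2) = (if t < L.+1 then t.+1 else 0)%N :> nat.
Proof.
have -> : (t + 1 : 'I_L.+2) = (t.+1 %% L.+2)%N :> nat by rewrite /= modnDmr addn1.
case: ifPn => [tL|]; first by rewrite modn_small.
rewrite -leqNgt => Lt; have -> : t = L.+1 :> nat.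
  by apply/eqP; rewrite eqn_leq Lt -ltnS ltn_ord.
by rewrite modnn.
Qed.

Lemma sum_indicator (T : finType) (P : pred T) :
  \sum_t (P t)%:R = #|P|%:R :> R.
Proof.
rewrite -sum1_card natr_sum [RHS]big_mkcond/=; apply: eq_bigr => t _.
by rewrite unfold_in; case: (P t).
Qed.

(** The indices counted lie strictly between [a] and [a + 2 * r / h], hence among the [m + 2]
    integers from [lo] on; [h <= r] absorbs the excess 2 into the factor 4. For negative [a], [lo]
    is 0, the least index anyway. *)
Lemma grid_line_card_le M h c r : 0 < h -> h <= r ->
  \sum_(t : 'I_L.+2) (`|h * t%:R - M - c| < r)%R%:R <= 4 * r / h.
Proof.
move=> h0 hr; rewrite sum_indicator.
set a := (c - r + M) / h; set lo := Num.truncn a; set m := Num.truncn (2 * r / h).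
have r0 : 0 < r by exact: lt_le_trans hr.
have rh : 1 <= r / h by rewrite ler_pdivlMr// mul1r.
apply: (@le_trans _ _ (m.+2)%:R); last first.
  have : m%:R <= 2 * r / h by rewrite truncn_le// divr_ge0// ?mulr_ge0// ltW.
  by rewrite -addn2 natrD; lra.
rewrite ler_nat cardE -(size_map val) -(size_iota lo m.+2).
apply: uniq_leq_size; first by rewrite map_inj_uniq ?enum_uniq//; exact: val_inj.
move=> _ /mapP[t + ->]; rewrite mem_enum unfold_in ltr_distl => /andP[ta tb].
have at0 : a < t%:R by rewrite ltr_pdivrMr// mulrC; lra.
have ta2 : t%:R < a + 2 * r / h.
  by rewrite -mulrDl ltr_pdivlMr// mulrC; lra.
rewrite mem_iota; apply/andP; split.
  by rewrite truncn_le_nat (lt_trans at0)// ltr_nat.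
have alo : a < lo.+1%:R by exact: truncnS_gt.
have blo : 2 * r / h < m.+1%:R by exact: truncnS_gt.
rewrite -(ltr_nat R) (lt_le_trans ta2)// -addSnnS natrD.
by rewrite ltW// ltrD.
Qed.

(** The [k] consecutive indices from [t0] on all qualify, and [k > r / h - 1 >= r / (2 * h)] because
    [r / h >= 2]. The bounds on [c] keep these indices inside the grid. *)
Lemma grid_line_card_ge M h c r : 0 < h -> h <= r / 2 -> - M <= c ->
  c + r <= h * L.+2%:R - M ->
  r / (2 * h) <= \sum_(t : 'I_L.+2) (`|h * t%:R - M - c| < r)%R%:R.
Proof.
move=> h0 hr Mc cr; rewrite sum_indicator.
have cM : 0 <= (c + M) / h by rewrite divr_ge0 ?(ltW h0)//; lra.
have rh : 2 <= r / h by rewrite ler_pdivlMr//; lra.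
set t0 := Num.truncn ((c + M) / h); set k := Num.truncn (r / h).
have t0le : t0%:R * h <= c + M by rewrite -ler_pdivlMr// truncn_le.
have t0gt : c + M < (t0%:R + 1) * h.
  by rewrite -ltr_pdivrMr// natr1 truncnS_gt.
have kle : k%:R * h <= r by rewrite -ler_pdivlMr// truncn_le//; lra.
have kgt : r / h < k%:R + 1 by rewrite natr1 truncnS_gt.
have sP (s : 'I_k) : `|h * (t0 + s)%:R - M - c| < r.
  have : s%:R + 1 <= k%:R :> R by rewrite natr1 ler_nat.
  move=> /(ler_wpM2r (ltW h0)) sk.
  have sh0 : 0 <= s%:R * h by rewrite mulr_ge0// ltW.
  by rewrite ltr_distl natrD; apply/andP; split; lra.
have sK (s : 'I_k) : (t0 + s < L.+2)%N.
  rewrite -(ltr_nat R) -(ltr_pM2l h0).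
  by have := sP s; rewrite ltr_distl => /andP[_]; lra.
apply: (@le_trans _ _ k%:R).
  by rewrite invfM mulrCA -[r / h]divr1; lra.
rewrite ler_nat -[X in (X <= _)%N]card_ord.
have inj : injective (fun s : 'I_k => Ordinal (sK s)).
  by move=> s s' [] /addnI /val_inj.
rewrite -(card_codom inj); apply: subset_leq_card.
by apply/fintype.subsetP => _ /codomP[s ->]; rewrite unfold_in /=.
Qed.

(* On the cyclic order, a convex set is entered at most once and left at most once. *)
Lemma cyclic_boundary_le2 (P : pred nat) :
  (forall a b d, (a <= b <= d)%N -> P a -> P d -> P b) ->
  \sum_(t : 'I_L.+2) `|(P t)%:R - (P (t + 1 : 'I_L.+2))%:R| <= 2 :> R.
Proof.
move=> cvxP.
pose A t := P t && ~~ P (t + 1 : 'I_L.+2).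
pose B t := ~~ P t && P (t + 1 : 'I_L.+2).
have -> : \sum_(t : 'I_L.+2) `|(P t)%:R - (P (t + 1 : 'I_L.+2))%:R| =
          \sum_t (A t)%:R + \sum_t (B t)%:R :> R.
  rewrite -big_split; apply: eq_bigr => t _; rewrite /A /B.
  by case: (P t); case: (P _); rewrite /= ?subrr ?normr0 ?subr0 ?sub0r
    ?normrN ?normr1 ?addr0 ?add0r.
rewrite !sum_indicator -natrD ler_nat -[2%N]/(1 + 1)%N leq_add//;
  apply/card_le1_eqP => t t'; rewrite !unfold_in => /andP[h1 h2] /andP[h3 h4];
  apply/val_inj; move: h1 h2 h3 h4; rewrite !val_ordS.
- wlog tt' : t t' / (t < t')%N.
    move=> H h1 h2 h3 h4; case: (ltngtP t t') => // tt'.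
      exact: H.
    by apply/esym; exact: H.
  move=> h1 + h3; rewrite (leq_trans tt') -1?ltnS ?ltn_ord// => /negP[].
  by apply: cvxP h1 h3; rewrite leqnSn.
- wlog tt' : t t' / (t < t')%N.
    move=> H h1 h2 h3 h4; case: (ltngtP t t') => // tt'.
      exact: H.
    by apply/esym; exact: H.
  move=> h1; rewrite (leq_trans tt') -1?ltnS ?ltn_ord// => h2 h3.
  (* Two entries at [t < t']: without wrapping, [t + 1 <= t' <= t' + 1] forces [t'] into [P]; with
     wrapping, [t' + 1] is 0 and [0 <= t <= t + 1] forces [t] into [P]. *)
  case: ifPn => t'L h4.
    by case/negP: h3; apply: cvxP h2 h4; rewrite tt' leqnSn.
  by case/negP: h1; apply: cvxP h4 h2; rewrite leqnSn.
Qed.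

End LineGrid.

Section Grid.
Context {R : realType} {n L : nat}.
Local Notation V := 'rV[R]_n.
Local Notation T := {ffun 'I_n -> 'I_L.+2}.
Variables (M h : R).
Implicit Types (z : T) (Q : V * R) (s : seq (V * R)).

(* The torus [T] indexes the grid of mesh [h] in the box [[-M, h (L + 2) - M[^n];
   [gridstep i] wraps around at its last layer. *)
Definition gridpt z : V := \row_j (h * (z j)%:R - M).

Definition gridstep (i : 'I_n) : T := [ffun j => if j == i then 1 else 0].

(** The indicator of the open cube with centre [Q.1] and half-side [Q.2], a ball of the sup norm. In
    product form, its sums over the torus factor into counts on lines. *)
Definition in_cube Q z : R :=
  \prod_j (`|h * (z j)%:R - M - Q.1 0 j| < Q.2)%R%:R.

Lemma in_cubeE Q z : 0 < Q.2 -> in_cube Q z = (`|gridpt z - Q.1| < Q.2)%R%:R.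
Proof.
move=> Q0; have -> : (`|gridpt z - Q.1| < Q.2) =
    [forall j, `|h * (z j)%:R - M - Q.1 0 j| < Q.2].
  apply/idP/forallP => [H j|H].
    move: H; rewrite [ltLHS]/Num.Def.normr/= mx_normrE => /bigmax_ltP[_ /(_ (0, j) isT)].
    by rewrite !mxE.
  rewrite [ltLHS]/Num.Def.normr/= mx_normrE; apply/bigmax_ltP; split => // -[i j] _ /=.
  by rewrite ord1 !mxE.
rewrite /in_cube; case: forallP => [H|/forallP]; first by apply: big1 => j _; rewrite H.
by rewrite negb_forall => /existsP[j /negbTE Hj]; rewrite (bigD1 j)//= Hj mul0r.
Qed.

Lemma in_cube_ge0 Q z : 0 <= in_cube Q z.
Proof. exact: prodr_ge0. Qed.

Lemma in_cube_le1 Q z : in_cube Q z <= 1.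
Proof. by apply: prodr_ile1 => j _; rewrite ler0n; case: (_ < _); rewrite ?lexx ?ler01. Qed.

Lemma sum_in_cube_le Q : 0 < h -> h <= Q.2 ->
  \sum_z in_cube Q z <= (4 * Q.2 / h) ^+ n.
Proof.
move=> h0 hQ.
rewrite -(bigA_distr_bigA (fun j (t : 'I_L.+2) => (`|h * t%:R - M - Q.1 0 j| < Q.2)%R%:R)).
have -> : (4 * Q.2 / h) ^+ n = \prod_(j < n) (4 * Q.2 / h).
  by rewrite prodr_const card_ord.
apply: ler_prod => j _.
by rewrite sumr_ge0//= grid_line_card_le.
Qed.

Lemma sum_in_cube_ge Q : 0 < h -> h <= Q.2 / 2 ->
  (forall j, - M <= Q.1 0 j) -> (forall j, Q.1 0 j + Q.2 <= h * L.+2%:R - M) ->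
  (Q.2 / (2 * h)) ^+ n <= \sum_z in_cube Q z.
Proof.
move=> h0 hQ MQ QM.
rewrite -(bigA_distr_bigA (fun j (t : 'I_L.+2) => (`|h * t%:R - M - Q.1 0 j| < Q.2)%R%:R)).
have -> : (Q.2 / (2 * h)) ^+ n = \prod_(j < n) (Q.2 / (2 * h)).
  by rewrite prodr_const card_ord.
apply: ler_prod => j _.
by rewrite divr_ge0/= ?grid_line_card_ge//; lra.
Qed.

(** The jump in direction [i] factors over the coordinates: coordinate [i] contributes at most one
    entry and one exit, and each of the other [n - 1] contributes a count on a line. *)
Lemma sum_in_cube_boundary_le i Q : 0 < h -> h <= Q.2 ->
  \sum_z `|in_cube Q z - in_cube Q (z + gridstep i)| <= 2 * (4 * Q.2 / h) ^+ n.-1.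
Proof.
move=> h0 hQ.
pose P j (t : nat) := `|h * t%:R - M - Q.1 0 j| < Q.2.
pose G j (t : 'I_L.+2) : R :=
  if j == i then `|(P j t)%:R - (P j (t + 1 : 'I_L.+2))%:R| else (P j t)%:R.
have -> : \sum_z `|in_cube Q z - in_cube Q (z + gridstep i)| =
          \sum_(z : T) \prod_j G j (z j).
  apply: eq_bigr => z _; rewrite /in_cube (bigD1 i)//= [X in _ - X](bigD1 i)//=.
  rewrite [RHS](bigD1 i)//= /G eqxx !ffunE eqxx.
  rewrite [X in _ - _ * X](eq_bigr (fun j => (P j (z j))%:R)); last first.
    by move=> j /negbTE ji; rewrite !ffunE ji addr0.
  rewrite -mulrBl normrM [X in _ * X]ger0_norm ?prodr_ge0//; congr (_ * _).
  by apply: eq_bigr => j /negbTE ->.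
rewrite -bigA_distr_bigA (bigD1 i)//=; apply: ler_pM.
- by rewrite sumr_ge0// => t _; rewrite /G eqxx.
- by rewrite prodr_ge0// => j ji; rewrite sumr_ge0// => t _; rewrite /G (negbTE ji).
- under eq_bigr do rewrite /G eqxx.
  apply: (@cyclic_boundary_le2 R L (P i)) => a b d /andP[ab bd].
  rewrite /P !ltr_distl => /andP[a1 _] /andP[_ d2].
  have := ler_wpM2l (ltW h0); have : a%:R <= b%:R :> R by rewrite ler_nat.
  have : b%:R <= d%:R :> R by rewrite ler_nat.
  move=> bd' ab' H; have := H _ _ bd'; have := H _ _ ab' => ? ?.
  by apply/andP; split; lra.
- have -> : n.-1 = #|[pred j | j != i]| by rewrite (cardC1 i) card_ord.
  rewrite -prodr_const; apply: ler_prod => j ji.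
  rewrite sumr_ge0 => [|t _]; last by rewrite /G (negbTE ji).
  by under eq_bigr do rewrite /G (negbTE ji); exact: grid_line_card_le.
Qed.

(** Exchanging the factors one at a time costs at most [|a k - b k|] each, the remaining factors
    lying in [[0, 1]]. This bounds the variation of the cut-off by the sum of those of the single
    cubes. *)
Lemma norm_prodB_le (I : Type) (s : seq I) (a b : I -> R) :
  (forall k, 0 <= a k <= 1) -> (forall k, 0 <= b k <= 1) ->
  `|\prod_(k <- s) a k - \prod_(k <- s) b k| <= \sum_(k <- s) `|a k - b k|.
Proof.
move=> a01 b01; elim: s => [|k s IH]; first by rewrite !big_nil subrr normr0.
rewrite !big_cons; set A := \prod_(j <- s) a j in IH *; set B := \prod_(j <- s) b j in IH *.
have A01 : 0 <= A <= 1.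
  by rewrite prodr_ge0 ?prodr_ile1// => j; have /andP[] := a01 j.
have /andP[bk0 bk1] := b01 k; have /andP[A0 A1] := A01.
rewrite (_ : _ - _ = (a k - b k) * A + b k * (A - B)); last by ring.
rewrite (le_trans (ler_normD _ _))// !normrM lerD//.
  by rewrite ler_piMr// ger0_norm.
by rewrite (le_trans _ IH)// ler_piMl// ger0_norm.
Qed.

Definition off_cubes s z : R := \prod_(Q <- s) (1 - in_cube Q z).

(* Summation by parts on the torus moves the difference onto the cut-off
   [off_cubes s], which only varies at the boundary of the cubes. *)
Lemma grid_flux_le s (Y : 'I_n -> T -> R) (C : R) : 0 < h ->
  {in s, forall Q, h <= Q.2} -> (forall i z, `|Y i z| <= C) ->
  \sum_z off_cubes s z * \sum_i (Y i (z + gridstep i) - Y i z) <=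
  C * n%:R * \sum_(Q <- s) 2 * (4 * Q.2 / h) ^+ n.-1.
Proof.
move=> h0 hs YC.
under eq_bigr do rewrite mulr_sumr.
rewrite exchange_big/= -mulrA mulrCA.
set B := C * _; have -> : n%:R * B = \sum_(i < n) B.
  by rewrite sumr_const card_ord mulr_natl.
apply: ler_sum => i _.
have -> : \sum_z off_cubes s z * (Y i (z + gridstep i) - Y i z) =
    \sum_z (off_cubes s z - off_cubes s (z + gridstep i)) * Y i (z + gridstep i).
  under eq_bigr do rewrite mulrBr.
  under [RHS]eq_bigr do rewrite mulrBl.
  by rewrite !sumrB; congr (_ - _); rewrite (reindex_inj (addIr (gridstep i))).
rewrite (le_trans (ler_norm _))// (le_trans (ler_norm_sum _ _ _))//.
apply: (@le_trans _ _ (\sum_z C * \sum_(Q <- s) `|in_cube Q z - in_cube Q (z + gridstep i)|)).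
  apply: ler_sum => z _; rewrite normrM mulrC ler_pM//.
  have cube01 Q z' : 0 <= 1 - in_cube Q z' <= 1.
    by have := in_cube_ge0 Q z'; have := in_cube_le1 Q z'; lra.
  rewrite (le_trans (norm_prodB_le _ _ _))//; apply: ler_sum => Q _.
  by rewrite distrC (_ : _ - _ - _ = in_cube Q z - in_cube Q (z + gridstep i))//; ring.
rewrite -mulr_sumr; apply: ler_wpM2l.
  by rewrite (le_trans _ (YC i 0)).
rewrite exchange_big/= big_seq [leRHS]big_seq; apply: ler_sum => Q /hs hQ.
exact: sum_in_cube_boundary_le.
Qed.

End Grid.

(** * Covering a null set by cubes *)

Section EuclNorm.
Context {R : realType} {n : nat}.
Local Notation V := 'rV[R]_n.
Implicit Types (w x : V).

Lemma eucl_norm_ge0 w : 0 <= eucl_norm w.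
Proof. exact: sqrtr_ge0. Qed.

Lemma eucl_norm_sqr w : eucl_norm w ^+ 2 = \sum_(i < n) w 0 i ^+ 2.
Proof. by rewrite sqr_sqrtr// sumr_ge0// => i _; exact: sqr_ge0. Qed.

Lemma coord_le_eucl_norm w i : `|w 0 i| <= eucl_norm w.
Proof.
rewrite -(ler_pXn2r (n := 2))// ?nnegrE ?eucl_norm_ge0//.
rewrite eucl_norm_sqr (bigD1 i)//= real_normK ?num_real// lerDl.
by rewrite sumr_ge0// => j _; exact: sqr_ge0.
Qed.

Lemma norm_le_eucl_norm w : `|w| <= eucl_norm w.
Proof.
rewrite [leLHS]/Num.Def.normr/= mx_normrE; apply/bigmax_leP; split => [|[i j] _ /=].
  exact: eucl_norm_ge0.
by rewrite ord1 coord_le_eucl_norm.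
Qed.

Lemma eucl_norm_eq0 w : (eucl_norm w == 0) = (w == 0).
Proof.
apply/eqP/eqP => [w0|->].
  by apply/eqP; rewrite -normr_eq0 eq_le normr_ge0 andbT -w0 norm_le_eucl_norm.
by rewrite /eucl_norm big1 ?sqrtr0// => i _; rewrite mxE expr0n.
Qed.

End EuclNorm.

Section NullCover.
Context {R : realType} {n : nat}.
Local Notation V := 'rV[R]_n.
Implicit Types (K C : set V) (s : seq (V * R)).

(** [hcost] passes through [fine], which sends infinite values to 0; a bounded diameter and a point
    of [C] rule this out. The sup norm is below the Euclidean one, so [C] fits in a closed cube
    around any of its points. *)
Lemma diam_fin C (delta : R) c : (diam C <= delta%:E)%E -> C c ->
  [/\ 0 <= fine (diam C), fine (diam C) <= delta, diam C = (fine (diam C))%:E &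
   forall x, C x -> `|x - c| <= fine (diam C)].
Proof.
move=> Cd Cc.
have ub x y : C x -> C y -> ((eucl_norm (x - y))%:E <= diam C)%E.
  by move=> Cx Cy; apply: ereal_sup_ubound; exists x => //; exists y.
have d0 : (0 <= diam C)%E by apply: le_trans (ub _ _ Cc Cc); rewrite lee_fin eucl_norm_ge0.
have dfin : diam C \is a fin_num.
  by rewrite ge0_fin_numE// (le_lt_trans Cd) ?ltry.
have dE : diam C = (fine (diam C))%:E by rewrite fineK.
split=> //; first exact: fine_ge0.
  by rewrite -lee_fin -dE.
move=> x Cx; rewrite (le_trans (norm_le_eucl_norm _))//.
by rewrite -lee_fin -dE; exact: ub.
Qed.

(** Each set of a cheap countable cover that meets [K] is enclosed in a slightly larger open cube
    centred in [K], and compactness leaves finitely many. The centres in [K] later keep the cubes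
    away from points far from [K]. *)
Lemma null_cover m K (eps delta : R) :
  compact K -> hausdorff_measure m K = 0%E -> 0 < eps -> 0 < delta ->
  exists s, [/\ {in s, forall Q, K Q.1 /\ 0 < Q.2 <= delta},
    forall x, K x -> exists2 Q, Q \in s & `|x - Q.1| < Q.2 &
    \sum_(Q <- s) Q.2 ^+ m <= eps].
Proof.
move=> cK HK eps0 delta0.
have d2 : 0 < delta / 2 by rewrite divr_gt0.
have e2 : 0 < eps / 2 by rewrite divr_gt0.
(* Halving [delta] leaves room for radii above the diameters, and halving [eps] pays for the
   enlargement. *)
have : (hausdorff_content m (delta / 2) K < (eps / 2)%:E)%E.
  apply: (@le_lt_trans _ _ 0%E); last by rewrite lte_fin.
  by rewrite -HK; apply: ereal_sup_ubound; exists (delta / 2).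
move=> /ereal_inf_lt[_ [Cs [KC Cd] <-]] cost.
pose D k := exists2 c, Cs k c & K c.
have hcostE k : D k -> hcost m (Cs k) = (fine (diam (Cs k)) ^+ m)%:E.
  by move=> [c Cc _]; rewrite /hcost; case: pselect => // C0; rewrite C0 in Cc.
have hcost_ge0 k : (0 <= hcost m (Cs k))%E.
  rewrite /hcost; case: pselect => // C0.
  have /set0P[c Cc] : Cs k != set0 by apply/eqP.
  by rewrite lee_fin exprn_ge0//; have [] := diam_fin (Cd k) Cc.
have /choice[p pP] : forall k, exists p : V * R, D k ->
    [/\ K p.1, 0 < p.2 <= delta, forall x, Cs k x -> `|x - p.1| < p.2 &
     p.2 ^+ m <= fine (diam (Cs k)) ^+ m + eps / 2 * 2^-1 ^+ k.+1].
  move=> k; have [[c Cc Kc]|nD] := pselect (D k); last by exists (0, 0).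
  have [d0 dd dE dx] := diam_fin (Cd k) Cc.
  set d := fine _ in d0 dd dx *.
  have ek : 0 < eps / 2 * 2^-1 ^+ k.+1 by rewrite mulr_gt0// exprn_gt0.
  (* The radius must exceed the diameter for the open cube to contain the set; by continuity of the
     power, the extra cost stays within the [k]-th term of a geometric series of sum [eps / 2]. *)
  have /cvgrPdist_lt/(_ _ ek) nd : x ^+ m @[x --> d^'+] --> d ^+ m.
    by apply: cvg_within_filter; exact: exprn_continuous.
  have /filter_ex[r [rd rdelta /= rm]] : \forall r \near d^'+,
      [/\ d < r, r < delta & `|d ^+ m - r ^+ m| < eps / 2 * 2^-1 ^+ k.+1].
    near=> r; split; near: r => //; first exact: nbhs_right_gt.
    by apply: nbhs_right_lt; lra.
  exists (c, r) => _; split => //=.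
  - by rewrite (le_lt_trans d0)//= ltW.
  - by move=> x /dx /le_lt_trans; exact.
  - by move: rm; rewrite distrC ltr_distl => /andP[_ /ltW].
have [D' D'D KD'] : finite_subset_cover D (fun k => ball (p k).1 (p k).2) K.
  have : compact K by [].
  rewrite compact_cover; apply.
    by move=> k _; exact: ball_open.
  move=> x Kx; have [k _ Cx] := KC _ Kx.
  have Dk : D k by exists x.
  exists k => //; have [_ _ /(_ x Cx) + _] := pP _ Dk.
  by rewrite -ball_normE /ball_ /= distrC.
have [N NP] : exists N, forall k : nat, k \in finmap.enum_fset D' -> (k < N)%N.
  exists (\max_(k <- finmap.enum_fset D') k).+1 => k kD'.
  by rewrite ltnS leq_bigmax_seq.
(* All indices of [D] below [N] are kept: they include the finite subcover, and their cost is still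
   bounded by the whole series. *)
exists [seq p k | k <- iota 0 N & `[< D k >]]; split.
- move=> _ /mapP[k + ->]; rewrite mem_filter => /andP[/asboolP Dk _].
  by have [] := pP _ Dk.
- move=> x /KD'[k /= kD' kx]; exists (p k).
    apply: (@map_f _ _ p _ (k : nat)).
    rewrite mem_filter mem_iota add0n leq0n NP// !andbT.
    by apply/asboolP; have := D'D _ kD'; rewrite inE.
  by move: kx; rewrite -ball_normE /ball_ /= distrC.
rewrite big_map big_filter big_mkcond/=.
apply: (@le_trans _ _ (\sum_(0 <= k < N) fine (hcost m (Cs k)) * (`[< D k >])%:R +
   \sum_(0 <= k < N) eps / 2 * 2^-1 ^+ k.+1)).
  rewrite -big_split/= /index_iota subn0; apply: ler_sum => k _.
  case: asboolP => Dk; last by rewrite mulr0 add0r mulr_ge0 ?exprn_ge0// ltW.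
  by rewrite mulr1 hcostE//=; have [] := pP _ Dk.
rewrite [leRHS](splitr eps) lerD//; last first.
  rewrite -mulr_sumr ler_piMr ?(ltW e2)//.
  have -> : \sum_(0 <= k < N) 2^-1 ^+ k.+1 = 1 - 2^-1 ^+ N :> R.
    elim: (N) => [|j IH]; first by rewrite big_geq// expr0 subrr.
    by rewrite big_nat_recr//= IH exprS; field.
  by rewrite lerBlDr lerDl exprn_ge0.
rewrite -lee_fin (le_trans _ (ltW cost))//.
apply: le_trans (nneseries_lim_ge N _) => //; rewrite -sumEFin.
apply: lee_sum => k _; case: asboolP => Dk; last by rewrite mulr0.
by rewrite mulr1 hcostE.
Unshelve. all: by end_near. Qed.

End NullCover.

(** * Vanishing of a nonnegative divergence *)

Section VanishingDivergence.
Context {R : realType} {n : nat}.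
Local Notation N := n.+1.
Local Notation V := 'rV[R]_N.
Implicit Types (K : set V) (s : seq (V * R)).

(** The mesh divides the side [2 * M] exactly, so that wrapping around glues the face at [M] to the
    face at [- M]. *)
Lemma exists_mesh (M delta : R) : 0 < M -> 0 < delta ->
  exists L, [/\ 0 < 2 * M / L.+2%:R, 2 * M / L.+2%:R < delta &
    2 * M / L.+2%:R * L.+2%:R - M = M].
Proof.
move=> M0 d0; exists (Num.truncn (2 * M / delta)).
set L := Num.truncn _; have L0 : 0 < L.+2%:R :> R by [].
split; first by rewrite divr_gt0// mulr_gt0.
  rewrite ltr_pdivrMr// [ltRHS]mulrC -ltr_pdivrMr//.
  by have := truncnS_gt (2 * M / delta); rewrite -/L => /lt_trans; apply; rewrite ltr_nat.
by rewrite divfK ?gt_eqF//; lra.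
Qed.

Lemma exists_le_sides s : {in s, forall Q, 0 < Q.2} ->
  exists2 delta : R, 0 < delta & {in s, forall Q, delta <= Q.2}.
Proof.
elim: s => [|Q s IH] sP; first by exists 1.
have [|delta d0 dP] := IH; first by move=> Q' Q's; apply: sP; rewrite inE Q's orbT.
exists (Num.min delta Q.2); first by rewrite lt_min d0 sP ?mem_head.
by move=> Q'; rewrite inE => /orP[/eqP ->|/dP]; rewrite ge_min ?lexx ?orbT// => ->.
Qed.

Lemma coord_le_norm (x : V) j : `|x 0 j| <= `|x|.
Proof.
by rewrite [leRHS]/Num.Def.normr/= mx_normrE; apply/bigmax_geP; right; exists (0, j).
Qed.

Lemma off_cubesE L (M h : R) s (z : {ffun 'I_N -> 'I_L.+2}) :
  {in s, forall Q, 0 < Q.2} ->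
  off_cubes M h s z = (all (fun Q => Q.2 <= `|gridpt M h z - Q.1|) s)%:R.
Proof.
elim: s => [|Q s IH] sP; first by rewrite /off_cubes big_nil.
rewrite /off_cubes big_cons [X in _ * X]IH ?in_cubeE ?sP ?mem_head//=.
  by rewrite leNgt; case: (_ < _); rewrite /= ?subrr ?mul0r ?subr0 ?mul1r.
by move=> Q' Q's; apply: sP; rewrite inE Q's orbT.
Qed.

(** Grid points are counted in two ways: a ball holds at least [(rho / (2 * h)) ^+ N] of them,
    whereas cubes covering it hold at most [(4 / h) ^+ N] times the sum of [Q.2 ^+ N]. As
    [Q.2 <= 1], this sum is at most the small sum of [Q.2 ^+ n]. *)
Lemma null_no_interior K p (rho : R) : compact K ->
  hausdorff_measure n K = 0%E -> 0 < rho -> ~ ball p rho `<=` K.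
Proof.
move=> cK HK rho0 pK.
(* Chosen from [rho / (2 * h) = 4 / h * (rho / 8)], so that the mesh cancels in the comparison; the
   half makes it strict. *)
have eps0 : 0 < (rho / 8) ^+ N / 2 by rewrite divr_gt0// exprn_gt0// divr_gt0.
have [s [sP Ks sums]] := null_cover cK HK eps0 ltr01.
have sP0 : {in s, forall Q, 0 < Q.2} by move=> Q /sP[_ /andP[]].
have [d1 d10 d1P] := exists_le_sides sP0.
have M0 : 0 < `|p| + rho by rewrite ltr_wpDl.
have [|L [h0 hd hM]] := @exists_mesh _ (Num.min d1 (rho / 2)) M0.
  by rewrite lt_min d10/= divr_gt0.
set M := `|p| + rho in M0 h0 hd hM; set h := 2 * M / _ in h0 hd hM.
move: hd; rewrite lt_min => /andP[hd1 hrho].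
have hs : {in s, forall Q, h <= Q.2}.
  by move=> Q /d1P; apply: le_trans; exact: ltW.
have lower : (rho / (2 * h)) ^+ N <=
    \sum_(z : {ffun 'I_N -> 'I_L.+2}) in_cube M h (p, rho) z.
  apply: (@sum_in_cube_ge R N L M h (p, rho)) => //=; first exact: ltW.
    move=> j; have := coord_le_norm p j; rewrite ler_norml => /andP[+ _].
    by rewrite /M; lra.
  move=> j; rewrite hM; have := coord_le_norm p j; rewrite ler_norml => /andP[_].
  by rewrite /M; lra.
have upper : \sum_(z : {ffun 'I_N -> 'I_L.+2}) in_cube M h (p, rho) z <=
    \sum_(Q <- s) (4 * Q.2 / h) ^+ N.
  apply: (@le_trans _ _ (\sum_(Q <- s) \sum_(z : {ffun 'I_N -> 'I_L.+2}) in_cube M h Q z)).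
    rewrite exchange_big/=; apply: ler_sum => z _.
    rewrite in_cubeE//=; case: ltP => [zp|_]; last first.
      by apply: sumr_ge0 => Q _; exact: in_cube_ge0.
    have [|Q Qs Qz] := Ks (gridpt M h z).
      by apply: pK; rewrite -ball_normE /ball_ /= distrC.
    rewrite (big_rem _ Qs)/= in_cubeE ?sP0// Qz lerDl sumr_ge0// => Q' _.
    exact: in_cube_ge0.
  by rewrite big_seq [leRHS]big_seq; apply: ler_sum => Q /hs; exact: sum_in_cube_le.
have : (4 / h) ^+ N * \sum_(Q <- s) Q.2 ^+ n < (rho / (2 * h)) ^+ N.
  have -> : rho / (2 * h) = (4 / h) * (rho / 8) by field; rewrite gt_eqF.
  rewrite [ltRHS]exprMn ltr_pM2l; last by rewrite exprn_gt0// divr_gt0.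
  by rewrite (le_lt_trans sums)//; lra.
apply/negP; rewrite -leNgt (le_trans lower)// (le_trans upper)//.
rewrite mulr_sumr big_seq [leRHS]big_seq; apply: ler_sum => Q /sP[_ /andP[Q0 Q1]].
rewrite (_ : 4 * Q.2 / h = 4 / h * Q.2); last by ring.
rewrite [leLHS]exprMn ler_wpM2l//; first by rewrite exprn_ge0// divr_ge0// ltW.
by rewrite exprS ler_piMl// exprn_ge0// ltW.
Qed.

(** Away from the last layer both points coincide. At the last layer the step leads to coordinate
    [M], its wrapped version to [- M], and [f] vanishes at both. *)
Lemma gridpt_step L (M h : R) i (z : {ffun 'I_N -> 'I_L.+2}) (f : V -> R) :
  0 < h -> h * L.+2%:R - M = M -> (forall x, M <= `|x| -> f x = 0) ->
  f (gridpt M h (z + gridstep i)) = f (h *: basis_vec R i + gridpt M h z).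
Proof.
move=> h0 hM f0; have [zi|zi] := ltnP (z i) L.+1.
  congr (f _); apply/rowP => j; rewrite !mxE/= !ffunE eq_sym.
  have [->|_] := eqVneq j i; last by rewrite addr0 mulr0 add0r.
  by rewrite val_ordS zi -[in LHS]natr1 (_ : true%:R = 1)//; ring.
have zL : z i = L.+1 :> nat.
  by apply/eqP; rewrite eqn_leq zi -ltnS ltn_ord.
rewrite !f0//.
  apply: le_trans (coord_le_norm _ i).
  suff -> : (h *: basis_vec R i + gridpt M h z) 0 i = M by exact: ler_norm.
  by rewrite !mxE !eqxx zL -[RHS]hM -[in RHS]natr1 (_ : _%:R = 1)//; ring.
apply: le_trans (coord_le_norm _ i).
by rewrite !mxE !ffunE eqxx val_ordS ltnNge zi mulr0 sub0r normrN ler_norm.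
Qed.

Lemma norm_gridpt_le L (M h : R) (z : {ffun 'I_N -> 'I_L.+2}) :
  0 < h -> 0 <= M -> h * L.+2%:R - M = M -> `|gridpt M h z| <= M.
Proof.
move=> h0 M0 hM; rewrite [leLHS]/Num.Def.normr/= mx_normrE.
apply/bigmax_leP; split => // -[i j] _ /=; rewrite mxE ler_norml.
have zL : (z j)%:R <= L.+2%:R :> R by rewrite ler_nat ltnW.
have := ler_wpM2l (ltW h0) zL; have : 0 <= h * (z j)%:R by rewrite mulr_ge0// ltW.
by move=> ? ?; apply/andP; split; lra.
Qed.

(* Discrete divergence theorem: on the grid points outside the cubes, uniform
   continuity makes difference quotients close to the divergence, and
   [grid_flux_le] bounds their sum by the total area of the cubes. *)
Lemma vanishing_divergence K (X : 'I_N -> V -> R) (M C : R) :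
  compact K -> hausdorff_measure n K = 0%E ->
  (forall i x, `|X i x| <= C) -> (forall i x, M <= `|x| -> X i x = 0) ->
  (forall i x, ~ K x -> C1at (basis_vec R i) (X i) x) ->
  (forall x, ~ K x -> 0 <= \sum_i partial (X i) i x) ->
  forall q, ~ K q -> \sum_i partial (X i) i q = 0.
Proof.
move=> cK HK XC X0 X1 div0 q Kq.
set Dv := fun x => \sum_i partial (X i) i x.
apply/eqP; rewrite eq_le div0// andbT leNgt; apply/negP => Dvq.
pose c := Dv q / 2; have c0 : 0 < c by rewrite divr_gt0.
have oK : open (~` K).
  by apply: closed_openC; apply: compact_closed => //; exact: norm_hausdorff.
have C0 : 0 <= C by apply: le_trans (XC 0 q).
have cDv : {for q, continuous Dv}.
  by apply: (@cvg_sum_ord R N V (nbhs q) (fun i => partial (X i) i)) => i;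
    exact: (C1at_derive (X1 i q Kq)).2.
have : \forall x \near q, ~ K x /\ c < Dv x.
  near=> x; split; first by near: x; exact: open_nbhs_nbhs.
  near: x; apply: (cvgr_gt (Dv q) cDv).
  by rewrite /c ltr_pdivrMr// ltr_pMr// ltr1n.
move=> /nbhs_ballP[r /= r0 rP].
(* Cubes centred in [K] with half-side at most [rho] miss the cube of half-side [rho] about [q],
   since [ball q r] misses [K]. *)
pose rho := r / 2; have rho0 : 0 < rho by rewrite divr_gt0.
pose M' := `|M| + `|q| + rho + 1.
have M'0 : 0 < M' by rewrite /M' ltr_pwDr// !addr_ge0// ltW.
(* After scaling by [h ^+ n], [a] is the gain from the cube about [q] and [B] the factor of the flux
   through the cubes. The covering makes the flux at most [a / 4], and [e] makes the total error of
   the difference quotients exactly [a / 4]; then [a - a / 4 <= a / 4] is absurd. *)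
pose a := c * (rho / 2) ^+ N.
have a0 : 0 < a by rewrite mulr_gt0// exprn_gt0// divr_gt0.
pose B := C * N%:R * 2 * 4 ^+ n.
have B0 : 0 <= B by rewrite !mulr_ge0// exprn_ge0.
have eps0 : 0 < a / (4 * (B + 1)) by rewrite divr_gt0// mulr_gt0// ltr_wpDl.
have [s [sP Ks sums]] := null_cover cK HK eps0 rho0.
have sP0 : {in s, forall Q, 0 < Q.2} by move=> Q /sP[_ /andP[]].
pose e := a / (4 * N%:R * (2 * M') ^+ N).
have e0 : 0 < e by rewrite divr_gt0// !mulr_gt0// exprn_gt0// mulr_gt0.
(* The part of the box outside the open cubes is compact and misses [K], so one step size serves all
   its points. *)
pose E := [set x : V | `|x| <= M'] `&` [set x | all (fun Q => Q.2 <= `|x - Q.1|) s].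
have cE : compact E.
  apply: bounded_closed_compact.
    by exists M'; split; [exact: num_real|] => y My x [/= xM _]; rewrite (le_trans xM)// ltW.
  apply: closedI.
    apply: (@closed_comp _ _ _ [set y : R | y <= M']); last exact: closed_le.
    by move=> x _; exact: norm_continuous.
  elim: s {sums Ks sP sP0 E} => [|Q s IH].
    by rewrite [X in closed X](_ : _ = setT) ?eqEsubset//; exact: closedT.
  rewrite [X in closed X](_ : _ = [set x | Q.2 <= `|x - Q.1|] `&`
      [set x | all (fun Q => Q.2 <= `|x - Q.1|) s]); last first.
    by apply/seteqP; split => [x /= /andP[]|x /= [-> ->]].
  apply: closedI => //.
  apply: (@closed_comp _ _ (fun x : V => `|x - Q.1|) [set y : R | Q.2 <= y]);
    last exact: closed_ge.
  move=> x _; have idx : (y : V) @[y --> x] --> x by exact: cvg_id.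
  exact: (cvg_norm (cvgB idx (cvg_cst Q.1))).
have EK x : E x -> ~ K x.
  move=> [_ /allP Ex] /Ks[Q Qs]; apply/negP; rewrite -leNgt; exact: Ex.
have : \forall h \near 0^'+, E `<=` (fun x => forall i,
    `|X i (h *: basis_vec R i + x) - X i x - h * partial (X i) i x| <= h * e).
  move/compact_near_coveringP : cE; apply => x /EK Kx.
  have Fi i := C1at_increment e0 (X1 i x Kx).
  have Fx : Filter (nbhs (x : V)) by exact: nbhs_filter.
  have FF : Filter (filter_prod (nbhs (x : V)) (0 : R)^'+) by exact: filter_prod_filter.
  exact: (@filterS _ _ FF _ _ _ (@filter_forall _ _ _ _ FF Fi)).
move=> [del /= del0 delP].
have [d1 d10 d1P] := exists_le_sides sP0.
have [|L [h0 hd hM]] := @exists_mesh M' (Num.min del (Num.min d1 (rho / 2))) M'0.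
  by rewrite !lt_min del0 d10/= divr_gt0.
move: (2 * M' / _) h0 hd hM => h h0 hd hM.
move: hd; rewrite !lt_min => /and3P[hdel hd1 hrho].
have hs : {in s, forall Q, h <= Q.2}.
  by move=> Q /d1P; apply: le_trans; exact: ltW.
have hP x : E x -> forall i,
    h * partial (X i) i x - h * e <= X i (h *: basis_vec R i + x) - X i x.
  move=> Ex i; have hb : ball (0 : R) del h.
    by rewrite -ball_normE /ball_ /= sub0r normrN gtr0_norm.
  have := delP h hb h0 x Ex i.
  by rewrite ler_norml => /andP[+ _]; lra.
pose T := {ffun 'I_N -> 'I_L.+2}.
pose Y i (z : T) := X i (gridpt M' h z).
have X0' i x : M' <= `|x| -> X i x = 0.
  move=> M'x; apply: X0; apply: le_trans M'x.
  have := ler_norm M; have := normr_ge0 q; rewrite /M' => ? ?; lra.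
(* Outside the cubes the divergence is at least [c] near [q] and nonnegative elsewhere, up to the
   error [e] per direction. Inside a cube the right side is 0, and the left side is nonpositive
   because [z] is then not near [q]. *)
have lowerz z : h * (c * in_cube M' h (q, rho) z - N%:R * e) <=
    off_cubes M' h s z * \sum_i (Y i (z + gridstep i) - Y i z).
  set x := gridpt M' h z.
  rewrite off_cubesE// in_cubeE//= -/x; case: (boolP (all _ s)) => [xs|].
    have Ex : E x by split => //; apply: norm_gridpt_le => //; exact: ltW.
    rewrite mul1r; apply: (@le_trans _ _ (\sum_i (h * partial (X i) i x - h * e))).
      rewrite sumrB -mulr_sumr sumr_const card_ord -[(h * e) *+ N]mulr_natl.
      rewrite mulrBr [h * (N%:R * e)]mulrCA lerB// ler_wpM2l ?(ltW h0)//.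
      case: ltP => [xq|_]; last by rewrite mulr0 div0//; exact: EK.
      rewrite mulr1; apply: ltW; apply: (rP _ _).2.
      by rewrite -ball_normE /ball_ /= distrC (lt_trans xq)// /rho; lra.
    apply: ler_sum => i _; rewrite /Y (gridpt_step _ _ h0 hM); last exact: X0'.
    exact: hP.
  rewrite mul0r -has_predC => /hasP[Q Qs /=]; rewrite -ltNge => Qx.
  have [KQ /andP[_ Qrho]] := sP Q Qs.
  rewrite pmulr_rle0// subr_le0; case: ltP => [xq|_]; last first.
    by rewrite mulr0 mulr_ge0// ltW.
  exfalso; apply: (rP Q.1 _).1 => //.
  rewrite -ball_normE /ball_ /= -[q - _](subrKA x) (le_lt_trans (ler_normD _ _))//.
  by rewrite distrC [ltRHS]splitr ltrD// (lt_le_trans Qx).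
have lower : h * (c * (rho / (2 * h)) ^+ N - N%:R * e * L.+2%:R ^+ N) <=
    \sum_(z : T) off_cubes M' h s z * \sum_i (Y i (z + gridstep i) - Y i z).
  apply: le_trans (ler_sum _ (fun z _ => lowerz z)).
  rewrite -mulr_sumr ler_wpM2l ?(ltW h0)// sumrB -mulr_sumr lerB//.
    rewrite ler_wpM2l ?(ltW c0)//; apply: (@sum_in_cube_ge R N L M' h (q, rho)) => //=.
    - exact: ltW.
    - move=> j; have := coord_le_norm q j; rewrite ler_norml => /andP[+ _].
      by have := normr_ge0 M; rewrite /M'; lra.
    - move=> j; rewrite hM; have := coord_le_norm q j; rewrite ler_norml => /andP[_].
      by have := normr_ge0 M; rewrite /M'; lra.
  by rewrite sumr_const card_ffun !card_ord -natrX -[_ *+ _]mulr_natr.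
have upper := @grid_flux_le R N L M' h s Y C h0 hs (fun i z => XC i (gridpt M' h z)).
have := le_trans lower upper.
apply/negP; rewrite -ltNge -(ltr_pM2l (exprn_gt0 n h0)).
have hN0 : h != 0 by rewrite gt_eqF.
have -> : h ^+ n * (C * N%:R * \sum_(Q <- s) 2 * (4 * Q.2 / h) ^+ n) =
    B * \sum_(Q <- s) Q.2 ^+ n.
  rewrite mulrCA !mulr_sumr; apply: eq_bigr => Q _.
  rewrite exprMn exprVn exprMn /B.
  have hn0 : h ^+ n != 0 by rewrite expf_neq0.
  by move: (h ^+ n) (4 ^+ n) (Q.2 ^+ n) hn0 => x y w x0; field.
have -> : h ^+ n * (h * (c * (rho / (2 * h)) ^+ N - N%:R * e * L.+2%:R ^+ N)) =
    a - a / 4.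
  rewrite mulrA -exprSr mulrBr; congr (_ - _).
    rewrite mulrCA -exprMn; congr (_ * _ ^+ _); field; exact: hN0.
  rewrite mulrCA -exprMn (_ : h * L.+2%:R = 2 * M'); last by lra.
  rewrite /e; field; rewrite ?expf_neq0 ?mulf_neq0 ?pnatr_eq0 ?gt_eqF//.
apply: (@le_lt_trans _ _ (a / 4)); last by lra.
apply: le_trans (ler_wpM2l B0 sums) _.
rewrite [leRHS](_ : _ = (B + 1) * (a / (4 * (B + 1)))); last first.
  by field; rewrite gt_eqF// ltr_wpDl.
by rewrite ler_wpM2r ?(ltW eps0)// lerDl.
Unshelve. all: by end_near. Qed.

End VanishingDivergence.

(** * Cut-off of the difference *)

Section Cutoff.
Context {R : realType}.
Implicit Types (t eps : R).

(** Squaring removes the corner of the positive part: at 0 the difference quotient is at most [|h|]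
    in modulus. *)
Lemma is_derive_sqr_max0 t :
  is_derive t 1 (fun x : R => Num.max x 0 ^+ 2) (2 * Num.max t 0).
Proof.
have [t0|t0|->] := ltgtP t 0.
- rewrite mulr0.
  apply: (near_eq_is_derive _ (is_derive_cst 0 t 1)).
  by near=> x; rewrite max_r ?expr0n//; apply: ltW; near: x; exact: lt_nbhsl.
- have sqrD : is_derive t 1 (fun x : R => x ^+ 2) (2 * t).
    have -> : 2 * t = t *: 1 + t *: 1 by rewrite [_ *: _]mulr1 mulr_natl mulr2n.
    exact: (is_deriveM (is_derive_id t 1) (is_derive_id t 1)).
  apply: (near_eq_is_derive _ sqrD).
  by near=> x; rewrite max_l//; apply: ltW; near: x; exact: lt_nbhsr.
rewrite ?maxxx mulr0.
have lim0 : (fun h : R => h^-1 *: (((fun x : R => Num.max x 0 ^+ 2) \o shift 0) (h *: 1) -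
    Num.max 0 0 ^+ 2)) @ 0^' --> (0 : R).
  apply/cvgrPdist_lt => e e0; near=> h.
  have h0 : h != 0 by near: h; exact: nbhs_dnbhs_neq.
  rewrite /= addr0 maxxx expr0n/= subr0 sub0r normrN [_ *: 1]mulr1 normrM normfV.
  rewrite (@le_lt_trans _ _ `|h|)//; last first.
    by near: h; exact: dnbhs0_lt.
  rewrite mulrC ler_pdivrMr ?normr_gt0// -expr2 -normrX ger0_norm ?sqr_ge0//.
  rewrite normrX lerXn2r ?nnegrE ?le_max ?lexx ?orbT//.
  by rewrite ge_max normr_ge0 ler_norm.
split; first by apply/cvg_ex; exists 0.
exact: cvg_lim lim0.
Unshelve. all: by end_near. Qed.

(* [s^2 / (1 + s^2)] with [s = max(t - eps, 0)] *)
Definition cutoff eps t := 1 - (1 + Num.max (t - eps) 0 ^+ 2)^-1.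

Definition cutoff' eps t :=
  (1 + Num.max (t - eps) 0 ^+ 2) ^- 2 * (2 * Num.max (t - eps) 0).

Lemma cutoff_den_gt0 eps t : 0 < 1 + Num.max (t - eps) 0 ^+ 2.
Proof. by rewrite ltr_pwDl// sqr_ge0. Qed.

Lemma cutoff_eq0 eps t : t <= eps -> cutoff eps t = 0.
Proof. by move=> te; rewrite /cutoff max_r ?subr_le0// expr0n/= addr0 invr1 subrr. Qed.

Lemma cutoff_itv eps t : 0 <= cutoff eps t <= 1.
Proof.
rewrite /cutoff subr_ge0 invf_le1 ?cutoff_den_gt0// lerDl sqr_ge0/=.
by rewrite gerBl invr_ge0 ltW// cutoff_den_gt0.
Qed.

Lemma cutoff'_ge0 eps t : 0 <= cutoff' eps t.
Proof.
rewrite /cutoff' mulr_ge0//; first by rewrite invr_ge0 exprn_ge0// ltW// cutoff_den_gt0.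
by rewrite mulr_ge0// le_max lexx orbT.
Qed.

Lemma cutoff'_gt0 eps t : eps < t -> 0 < cutoff' eps t.
Proof.
move=> et; rewrite /cutoff' mulr_gt0//; first by rewrite invr_gt0 exprn_gt0// cutoff_den_gt0.
by rewrite mulr_gt0// lt_max subr_gt0 et.
Qed.

Lemma is_derive_cutoff eps t : is_derive t 1 (cutoff eps) (cutoff' eps t).
Proof.
have D1 : is_derive t 1 (fun x : R => Num.max (x - eps) 0 ^+ 2) (2 * Num.max (t - eps) 0).
  have := @is_derive1_comp _ (fun x : R => Num.max x 0 ^+ 2) (fun x : R => x - eps)
     t _ 1 (is_derive_sqr_max0 (t - eps)).
  rewrite mulr1; apply.
  have := is_deriveB (is_derive_id t 1) (is_derive_cst eps t 1).
  by rewrite subr0.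
have D2 : is_derive t 1 (fun x : R => 1 + Num.max (x - eps) 0 ^+ 2) (2 * Num.max (t - eps) 0).
  by have := is_deriveD (is_derive_cst (1 : R) t 1) D1; rewrite add0r.
have D3 := @is_deriveV R (fun x => 1 + Num.max (x - eps) 0 ^+ 2) t _ _
  (lt0r_neq0 (cutoff_den_gt0 eps t)) D2.
have D4 := is_deriveB (is_derive_cst (1 : R) t 1) D3.
by rewrite sub0r scaleNr opprK in D4.
Qed.

Lemma continuous_cutoff' eps : continuous (cutoff' eps).
Proof.
move=> t.
have idt : (x : R) @[x --> t] --> t by exact: cvg_id.
have cm : Num.max (x - eps) 0 @[x --> t] --> Num.max (t - eps) 0.
  exact: (@continuous_max R R (fun x => x - eps) (cst 0) t
    (cvgB idt (cvg_cst eps)) (cvg_cst 0)).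
have cd : 1 + Num.max (x - eps) 0 ^+ 2 @[x --> t] --> 1 + Num.max (t - eps) 0 ^+ 2.
  exact: (cvgD (cvg_cst (1 : R)) (cvgM cm cm)).
have cd2 : (1 + Num.max (x - eps) 0 ^+ 2) ^- 2 @[x --> t] -->
    (1 + Num.max (t - eps) 0 ^+ 2) ^- 2.
  apply: cvgV; first by rewrite expf_neq0// lt0r_neq0// cutoff_den_gt0.
  exact: (cvgM cd cd).
exact: (cvgM cd2 (cvgM (cvg_cst (2 : R)) cm)).
Qed.

End Cutoff.

(** * The inverse square root on the positive axis *)

Section InvSqrt.
Context {R : realType}.

Lemma is_derive_inv_sqrt (t : R) : 0 < t ->
  is_derive t 1 (fun x => (Num.sqrt x)^-1) (- Num.sqrt t ^- 2 * (2 * Num.sqrt t)^-1).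
Proof.
move=> t0; apply: is_deriveV; first by rewrite gt_eqF// sqrtr_gt0.
exact: is_derive1_sqrt.
Qed.

Lemma continuous_inv_sqrt' (t : R) : 0 < t ->
  {for t, continuous (fun x : R => - Num.sqrt x ^- 2 * (2 * Num.sqrt x)^-1)}.
Proof.
move=> t0; have s0 : Num.sqrt t != 0 by rewrite gt_eqF// sqrtr_gt0.
have cs := @sqrt_continuous R t.
have c1 : - Num.sqrt x ^- 2 @[x --> t] --> - Num.sqrt t ^- 2.
  apply: cvgN; apply: cvgV; first by rewrite expf_neq0.
  exact: (cvgM cs cs).
have c2 : (2 * Num.sqrt x)^-1 @[x --> t] --> (2 * Num.sqrt t)^-1.
  by apply: cvgV; [rewrite mulf_neq0// pnatr_eq0|exact: (cvgM (cvg_cst (2 : R)) cs)].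
exact: (cvgM c1 c2).
Qed.

End InvSqrt.

(** * The normalized field *)

Section NormalizedField.
Context {R : realType} {n : nat}.
Local Notation V := 'rV[R]_n.
Implicit Types (A : set V) (u : V -> R) (F : V -> V) (q : V).

Lemma normalized_fieldE u F x i : normalized_field u F x 0 i =
  (Num.sqrt (\sum_(j < n) (partial u j x + F x 0 j) ^+ 2))^-1 *
  (partial u i x + F x 0 i).
Proof.
rewrite /normalized_field !mxE; congr ((Num.sqrt _)^-1 * _).
by apply: eq_bigr => j _; rewrite !mxE.
Qed.

Lemma normalized_field_le1 u F x i : `|normalized_field u F x 0 i| <= 1.
Proof.
rewrite mxE normrM normfV (ger0_norm (eucl_norm_ge0 _)).
(* The inverse of 0 is 0, so the field vanishes where [grad u + F] does and the bound holds
   everywhere. *)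
have [w0|w0] := eqVneq (eucl_norm (grad u x + F x)) 0.
  by rewrite w0 invr0 mul0r ler01.
rewrite mulrC ler_pdivrMr ?mul1r ?coord_le_eucl_norm//.
by rewrite lt_neqAle eq_sym w0 eucl_norm_ge0.
Qed.

Lemma sum_sqr_gt0 u F x : grad u x + F x != 0 ->
  0 < \sum_(j < n) (partial u j x + F x 0 j) ^+ 2.
Proof.
move=> w0; have -> : \sum_(j < n) (partial u j x + F x 0 j) ^+ 2 =
    eucl_norm (grad u x + F x) ^+ 2.
  by rewrite eucl_norm_sqr; apply: eq_bigr => j _; rewrite !mxE.
by rewrite exprn_gt0// lt_neqAle eq_sym eucl_norm_eq0 w0 eucl_norm_ge0.
Qed.

(* With [a = |α|] and unit vectors [ξ = α/a], [ζ = β/b], both sides equal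
   [(a + b) (1 - ξ.ζ)]. *)
Lemma normalized_field_monotone u v F x :
  grad u x + F x != 0 -> grad v x + F x != 0 ->
  \sum_(i < n) (partial u i x - partial v i x) *
     (normalized_field u F x 0 i - normalized_field v F x 0 i) =
  (eucl_norm (grad u x + F x) + eucl_norm (grad v x + F x)) / 2 *
  \sum_(i < n) (normalized_field u F x 0 i - normalized_field v F x 0 i) ^+ 2.
Proof.
have unit w : grad w x + F x != 0 ->
    (forall i, partial w i x + F x 0 i =
       eucl_norm (grad w x + F x) * normalized_field w F x 0 i) /\
    \sum_(i < n) normalized_field w F x 0 i ^+ 2 = 1.
  rewrite -eucl_norm_eq0 => w0; split.
    by move=> i; rewrite /normalized_field !mxE mulVKf.
  under eq_bigr do rewrite /normalized_field mxE exprMn.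
  by rewrite -mulr_sumr -eucl_norm_sqr exprVn mulVf// expf_neq0.
move=> /unit[uE u1] /unit[vE v1].
set a := eucl_norm _ in uE *; set b := eucl_norm (grad v x + _) in vE *.
set xi := normalized_field u F x in uE u1 *; set ze := normalized_field v F x in vE v1 *.
have -> : \sum_(i < n) (xi 0 i - ze 0 i) ^+ 2 = 2 - 2 * \sum_(i < n) xi 0 i * ze 0 i.
  under eq_bigr do rewrite sqrrB.
  rewrite big_split/= sumrB u1 v1 mulr_sumr.
  under eq_bigr do rewrite -mulr_natl.
  by ring.
under eq_bigr => i _.
  rewrite (_ : _ * _ = a * xi 0 i ^+ 2 + b * ze 0 i ^+ 2 - (a + b) * (xi 0 i * ze 0 i)).
    over.
  (* [F] cancels in the difference of the two unnormalized fields. *)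
  have -> : partial u i x - partial v i x = a * xi 0 i - b * ze 0 i.
    by rewrite -uE -vE; ring.
  by ring.
by rewrite sumrB big_split/= -!mulr_sumr u1 v1; field.
Qed.

(** Stated for any filter, because at points of [closure SF] outside [SF] the partial derivatives
    converge only relative to the complement of [SF]. *)
Lemma cvg_normalized_field (G : set_system V) {FG : Filter G} u F q i :
  (forall j, partial u j x @[x --> G] --> partial u j q) ->
  (forall j, F x 0 j @[x --> G] --> F q 0 j) ->
  grad u q + F q != 0 ->
  normalized_field u F x 0 i @[x --> G] --> normalized_field u F q 0 i.
Proof.
move=> cu cF q0; under eq_fun do rewrite normalized_fieldE.
rewrite normalized_fieldE.
have cw j : partial u j x + F x 0 j @[x --> G] --> partial u j q + F q 0 j.
  exact: (cvgD (cu j) (cF j)).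
apply: cvgM (cw i); apply: cvgV.
  by rewrite gt_eqF// sqrtr_gt0 sum_sqr_gt0.
apply: (continuous_cvg _ (@sqrt_continuous R _)).
by apply: cvg_sum_ord => j; exact: (cvgM (cw j) (cw j)).
Qed.

Lemma C1at_normalized_field e u F q i :
  (forall j, C1at e (partial u j) q) -> (forall j, C1at e (fun x => F x 0 j) q) ->
  grad u q + F q != 0 ->
  C1at e (fun x => normalized_field u F x 0 i) q.
Proof.
move=> Cu CF q0; under eq_fun do rewrite normalized_fieldE.
have Cw j : C1at e (fun x => partial u j x + F x 0 j) q by exact: C1atD.
apply: C1atM => //.
have S0 := sum_sqr_gt0 q0.
apply: (@C1at_comp _ _ e (fun x => \sum_(j < n) (partial u j x + F x 0 j) ^+ 2)
  (fun t => (Num.sqrt t)^-1) (fun t => - Num.sqrt t ^- 2 * (2 * Num.sqrt t)^-1)).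
- by apply: C1at_sum => j; apply: C1atM.
- by apply: filterS (lt_nbhsr S0) => t; exact: is_derive_inv_sqrt.
- exact: continuous_inv_sqrt'.
Qed.

Lemma within_continuous_cvg A (W : topologicalType) (f : V -> W) q :
  {within A, continuous f} -> A^° q -> {for q, continuous f}.
Proof.
move=> /subspace_continuousP fA Aq; have := fA q (interior_subset Aq).
by rewrite within_interior.
Qed.

Lemma C1on_C1at A (f : V -> R) q i : C1on A f -> A^° q ->
  {for q, continuous f} -> C1at (basis_vec R i) f q.
Proof.
move=> Cf Aq cf; split => //; exists (partial f i).
  by apply: filterS Aq => x /(Cf i).1 /derivableP.
exact: within_continuous_cvg (Cf i).2 Aq.
Qed.

End NormalizedField.

(** * The comparison argument *)

Lemma within_cvg (R : realType) n (W : topologicalType) (A B : set 'rV[R]_n)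
    (f : 'rV[R]_n -> W) p : A `<=` B -> {within B, continuous f} -> B p ->
  f @ within A (nbhs p) --> f p.
Proof.
move=> AB /subspace_continuousP/(_ p) fB /fB{}fB P /fB fBP.
exact: (@filterS _ (nbhs p) (nbhs_filter p) _ _ (fun x Px Ax => Px (AB x Ax)) fBP).
Qed.

Theorem theorem5p2 (R : realType) (n : nat) (Omega S1 S2 : set 'rV[R]_n)
    (F : 'rV[R]_n -> 'rV[R]_n) (u v : 'rV[R]_n -> R) :
  open Omega -> connected Omega -> bounded_set Omega ->
  S1 `<=` Omega -> S2 `<=` Omega ->
  C1field Omega F -> {within closure Omega, continuous F} ->
  {within closure Omega `\` S1, continuous u} ->
  {within closure Omega `\` S2, continuous v} ->
  let SF := S1 `|` S2 `|` crit_set Omega S1 u F `|` crit_set Omega S2 v F in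
  C2on (Omega `\` SF) u -> C2on (Omega `\` SF) v ->
  hausdorff_measure n.-1 (closure SF) = 0%E ->
  (forall p, (Omega `\` SF) p ->
     divergence (normalized_field v F) p <= divergence (normalized_field u F) p) ->
  (forall p, ((closure Omega `\` Omega) `\` SF) p -> u p <= v p) ->
  let Omega_plus := [set p | Omega p /\ 0 < u p - v p] in
  forall p, (Omega_plus `\` SF) p ->
    normalized_field u F p = normalized_field v F p.
Proof.
case: n Omega S1 S2 F u v => [|n] Omega S1 S2 F u v.
  (* In dimension 0 vectors have no coordinates, so any two are equal. *)
  by move=> *; apply/rowP; case.
move=> oO _ [M0 [_ OM0]] S1O S2O CF cF cu cv SF Cu Cv HK div_le bd Op p [[Omp wp] SFp].
have {M0 OM0} [M OM] : exists M, forall x, Omega x -> `|x| < M.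
  exists (M0 + 2) => x Ox; apply: (@le_lt_trans _ _ (M0 + 1)); last by lra.
  by apply: OM0 => //; lra.
have SFO : SF `<=` Omega.
  by move=> x [[[/S1O|/S2O]|[[? _] _]]|[[? _] _]].
set K := closure SF in HK *.
have cK : compact K.
  apply: bounded_closed_compact; last exact: closed_closure.
  exists M; split; first exact: num_real.
  move=> y My x Kx; apply: le_trans (ltW My).
  have clM : closed [set x : 'rV[R]_n.+1 | `|x| <= M].
    apply: (@closed_comp _ _ _ [set y : R | y <= M]); last exact: closed_le.
    by move=> z _; exact: norm_continuous.
  rewrite closure_id in clM.
  have SM : SF `<=` [set x : 'rV[R]_n.+1 | `|x| <= M].
    by move=> z /SFO /OM /ltW.
  by have := closure_subset SM Kx; rewrite -clM.
have SFK : SF `<=` K by exact: subset_closure.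
have oU : open (Omega `\` K).
  by apply: openI => //; apply: closed_openC; exact: closed_closure.
have US A : Omega `\` SF `<=` A -> forall x, (Omega `\` K) x -> A^° x.
  move=> UA x Ux; apply: filterS (open_nbhs_nbhs (conj oU Ux)) => y [Oy Ky].
  by apply: UA; split => // /SFK.
have inclO : Omega `\` SF `<=` closure Omega.
  by move=> x [Ox _]; exact: subset_closure.
have incl1 : Omega `\` SF `<=` closure Omega `\` S1.
  by move=> x [Ox Sx]; split; [exact: subset_closure|move=> S1x; apply: Sx; left; left; left].
have incl2 : Omega `\` SF `<=` closure Omega `\` S2.
  by move=> x [Ox Sx]; split; [exact: subset_closure|move=> S2x; apply: Sx; left; left; right].
have U_SF x : (Omega `\` K) x -> (Omega `\` SF) x.
  by move=> [Ox Kx]; split => // /SFK.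
(* A zero of [grad u + F] here would lie in [crit_set], whose derivability clause [C2on]
   supplies. *)
have gu0 x : (Omega `\` SF) x -> grad u x + F x != 0.
  move=> Ux; apply/eqP => g0; case: (Ux) => Ox; apply; left; right.
  split; last by split => // i; exact: (Cu.1 i).1.
  by split => // S1x; apply: Ux.2; left; left; left.
have gv0 x : (Omega `\` SF) x -> grad v x + F x != 0.
  move=> Ux; apply/eqP => g0; case: (Ux) => Ox; apply; right.
  split; last by split => // i; exact: (Cv.1 i).1.
  by split => // S2x; apply: Ux.2; left; left; right.
have C1u x i : (Omega `\` K) x -> C1at (basis_vec R i) u x.
  move=> Ux; apply: (C1on_C1at i Cu.1); first exact: US.
  by apply: within_continuous_cvg cu _; exact: US.
have C1v x i : (Omega `\` K) x -> C1at (basis_vec R i) v x.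
  move=> Ux; apply: (C1on_C1at i Cv.1); first exact: US.
  by apply: within_continuous_cvg cv _; exact: US.
have C1F x i j : (Omega `\` K) x -> C1at (basis_vec R i) (fun y => F y 0 j) x.
  move=> Ux; apply: (C1on_C1at i (CF j)); first exact: US.
  have cFx : {for x, continuous F}.
    by apply: within_continuous_cvg cF _; exact: US.
  exact: (continuous_comp cFx (@coord_continuous _ _ _ 0 j _)).
have C1N w x i : C2on (Omega `\` SF) w -> (Omega `\` K) x -> grad w x + F x != 0 ->
    C1at (basis_vec R i) (fun y => normalized_field w F y 0 i) x.
  move=> [C1w C2w] Ux w0; apply: C1at_normalized_field => // j; last exact: C1F.
  apply: (C1on_C1at i (C2w j)); first exact: US.
  by apply: within_continuous_cvg (C1w j).2 _; exact: US.
pose w x := u x - v x.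
pose W i x := normalized_field u F x 0 i - normalized_field v F x 0 i.
have C1w x i : (Omega `\` K) x -> C1at (basis_vec R i) w x.
  by move=> Ux; apply: C1atB; [exact: C1u|exact: C1v].
have C1W x i : (Omega `\` K) x -> C1at (basis_vec R i) (W i) x.
  move=> Ux; apply: C1atB; apply: C1N => //; [apply: gu0|apply: gv0]; exact: U_SF.
have eq_off_K q : (Omega `\` K) q -> 0 < w q ->
    normalized_field u F q = normalized_field v F q.
  (* Half of [w q] puts [q] where the cut-off is strictly increasing. *)
  move=> Uq wq; pose eps := w q / 2.
  have eps0 : 0 < eps by rewrite divr_gt0.
  pose X i x := if `[< (Omega `\` K) x >] then cutoff eps (w x) * W i x else 0.
  have XU x i : (Omega `\` K) x ->
      \forall y \near x, cutoff eps (w y) * W i y = X i y.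
    move=> Ux; apply: filterS (open_nbhs_nbhs (conj oU Ux)) => y Uy.
    by rewrite /X asboolT.
  (* Only boundary points need an argument: there [u - v <= 0 < eps], and continuity relative to
     [Omega] minus [K] keeps [w] below [eps] nearby, where the cut-off is 0. *)
  have X0 x i : ~ K x -> ~ Omega x -> \forall y \near x, 0 = X i y.
    move=> Kx Ox.
    have [clx|clx] := pselect (closure Omega x); last first.
      have : nbhs x (~` closure Omega).
        by apply: open_nbhs_nbhs; split => //; apply: closed_openC; exact: closed_closure.
      apply: filterS => y Oy; rewrite /X asboolF// => -[/subset_closure Oy' _].
      exact: Oy.
    have cux : u @ within (Omega `\` K) (nbhs x) --> u x.
      apply: within_cvg cu _; first by move=> y /U_SF /incl1.
      by split => // /S1O.
    have cvx : v @ within (Omega `\` K) (nbhs x) --> v x.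
      apply: within_cvg cv _; first by move=> y /U_SF /incl2.
      by split => // /S2O.
    have cwx : w @ within (Omega `\` K) (nbhs x) --> w x by exact: (cvgB cux cvx).
    have wx : w x < eps.
      apply: le_lt_trans eps0; rewrite subr_le0; apply: bd.
      by split => // /SFK.
    have near_lt : nbhs x (fun y => (Omega `\` K) y -> w y < eps).
      exact: (cvgr_lt (w x) cwx eps wx).
    apply: filterS near_lt => y wy; rewrite /X; case: asboolP => // Uy.
    by rewrite cutoff_eq0 ?mul0r//; apply: ltW; exact: wy.
  have X1 i x : ~ K x -> C1at (basis_vec R i) (X i) x.
    move=> Kx; have [Ox|Ox] := pselect (Omega x); last first.
      by apply: near_eq_C1at (X0 x i Kx Ox) _; exact: C1at_cst.
    have Ux : (Omega `\` K) x := conj Ox Kx.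
    apply: near_eq_C1at (XU x i Ux) _; apply: C1atM; last exact: C1W.
    apply: (@C1at_comp _ _ _ w (cutoff eps) (cutoff' eps)) => //; first exact: C1w.
      by near=> t; exact: is_derive_cutoff.
    exact: continuous_cutoff'.
  (* The product rule separates the two sources of nonnegativity: monotonicity of normalization and
     the assumed inequality of divergences. *)
  have divX x : (Omega `\` K) x -> \sum_i partial (X i) i x =
      cutoff' eps (w x) * (\sum_i (partial u i x - partial v i x) * W i x) +
      cutoff eps (w x) *
        (divergence (normalized_field u F) x - divergence (normalized_field v F) x).
    move=> Ux; rewrite /divergence -sumrB !mulr_sumr -big_split/=.
    apply: eq_bigr => i _.
    have dof f : C1at (basis_vec R i) f x -> is_derive x (basis_vec R i) f (partial f i x).
      by move=> /C1at_derive[/nbhs_singleton /derivableP].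
    have Du := dof _ (C1u x i Ux); have Dv := dof _ (C1v x i Ux).
    have DNu := dof _ (C1N u x i Cu Ux (gu0 _ (U_SF _ Ux))).
    have DNv := dof _ (C1N v x i Cv Ux (gv0 _ (U_SF _ Ux))).
    have Dw : is_derive x (basis_vec R i) w (partial u i x - partial v i x).
      exact: is_deriveB.
    have DW := is_deriveB DNu DNv.
    have Dc := is_derive_comp Dw (is_derive_cutoff eps (w x)).
    have [_] := near_eq_is_derive (XU x i Ux) (is_deriveM Dc DW).
    rewrite /partial => ->; rewrite /= addrC; congr (_ + _).
    by rewrite [_ *: _]mulrC mulrA.
  have mono x (Ux : (Omega `\` K) x) :=
    normalized_field_monotone (gu0 _ (U_SF _ Ux)) (gv0 _ (U_SF _ Ux)).
  have B0 x : (Omega `\` K) x ->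
      0 <= \sum_i (partial u i x - partial v i x) * W i x.
    move=> Ux; rewrite /W mono// mulr_ge0//.
      by rewrite divr_ge0// addr_ge0// eucl_norm_ge0.
    by rewrite sumr_ge0// => i _; exact: sqr_ge0.
  have div0 x : ~ K x -> 0 <= \sum_i partial (X i) i x.
    move=> Kx; have [Ox|Ox] := pselect (Omega x); last first.
      rewrite big1// => i _; rewrite /partial.
      by rewrite -(near_eq_derive _ (X0 x i Kx Ox)) derive_cst.
    have Ux : (Omega `\` K) x := conj Ox Kx.
    rewrite (divX x Ux); apply: addr_ge0; apply: mulr_ge0.
    - exact: cutoff'_ge0.
    - exact: B0.
    - by have /andP[] := cutoff_itv eps (w x).
    - by rewrite subr_ge0; exact/div_le/U_SF.
  have XC i x : `|X i x| <= 2.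
    rewrite /X; case: asboolP => _; last by rewrite normr0.
    have /andP[c0 c1] := cutoff_itv eps (w x).
    rewrite normrM ger0_norm// -[2]mul1r ler_pM// (le_trans (ler_normB _ _))//.
    by rewrite -[leRHS]/(1 + 1) lerD// normalized_field_le1.
  have XM i x : M <= `|x| -> X i x = 0.
    by move=> Mx; rewrite /X asboolF// => -[/OM]; rewrite ltNge Mx.
  (* Two nonnegative terms add up to 0 at [q]. As [cutoff' eps (w q) > 0], the monotonicity sum is
     at most 0; being a positive multiple of the sum of the [W i q ^+ 2], it forces each [W i q] to
     vanish. *)
  have := vanishing_divergence cK HK XC XM X1 div0 Uq.2.
  rewrite (divX q Uq) => S0; apply/rowP => i; apply/eqP; rewrite -subr_eq0.
  have wq2 : eps < w q by rewrite /eps ltr_pdivrMr// ltr_pMr// ltr1n.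
  have cp := cutoff'_gt0 wq2.
  have c0 : 0 <= cutoff eps (w q) *
     (divergence (normalized_field u F) q - divergence (normalized_field v F) q).
    have /andP[? _] := cutoff_itv eps (w q).
    by rewrite mulr_ge0// subr_ge0; exact/div_le/U_SF.
  have : \sum_i (partial u i q - partial v i q) * W i q <= 0.
    by rewrite -(pmulr_rle0 _ cp) -oppr_ge0 (addr0_eq S0).
  have gq0 := gu0 q (U_SF _ Uq).
  rewrite /W mono//.
  have ab0 : 0 < (eucl_norm (grad u q + F q) + eucl_norm (grad v q + F q)) / 2.
    rewrite divr_gt0// ltr_pwDl ?eucl_norm_ge0//.
    by rewrite lt_neqAle eq_sym eucl_norm_eq0 gq0 eucl_norm_ge0.
  rewrite (pmulr_rle0 _ ab0) => Wle0; rewrite -sqrf_eq0 eq_le sqr_ge0 andbT.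
  apply: le_trans Wle0; rewrite (bigD1 i)//= lerDl sumr_ge0// => j _.
  exact: sqr_ge0.
have Up : (Omega `\` SF) p by [].
(* The point [p] may lie in [K]. If the fields differed at [p], then [W i != 0] and [w > 0] would
   persist nearby off [SF], yet each ball about [p] contains a point off [K], where the fields
   agree. *)
apply: contrapT => Nne.
have [i Wi] : exists i, W i p != 0.
  apply: contrapT => /forallNP W0; apply: Nne; apply/rowP => i.
  by have /negP := W0 i; rewrite negbK subr_eq0 => /eqP.
pose G := within (Omega `\` SF) (nbhs p).
have FG : Filter G by exact: within_filter.
have cFp j : F x 0 j @[x --> G] --> F p 0 j.
  have := within_cvg inclO cF (inclO _ Up).
  exact: (continuous_cvg _ (@coord_continuous _ _ _ 0 j _)).
have cN z : C2on (Omega `\` SF) z -> grad z p + F p != 0 ->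
    normalized_field z F x 0 i @[x --> G] --> normalized_field z F p 0 i.
  move=> [Cz _] z0; apply: cvg_normalized_field => // j.
  exact: within_cvg (Cz j).2 Up.
have cW : W i x @[x --> G] --> W i p.
  exact: (cvgB (cN u Cu (gu0 _ Up)) (cN v Cv (gv0 _ Up))).
have cw : w x @[x --> G] --> w p.
  exact: (cvgB (within_cvg incl1 cu (incl1 _ Up)) (within_cvg incl2 cv (incl2 _ Up))).
have : \forall x \near p, Omega x /\ ((Omega `\` SF) x -> W i x != 0 /\ 0 < w x).
  have n1 : nbhs p (fun x => (Omega `\` SF) x -> W i x != 0) by exact: cvgr_neq0 cW Wi.
  have n2 : nbhs p (fun x => (Omega `\` SF) x -> 0 < w x) by exact: (cvgr_gt (w p) cw).
  have nO : nbhs p Omega by exact: open_nbhs_nbhs.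
  apply: filterS3 n1 n2 nO => x h1 h2 Ox; split => // Ux.
  by split; [exact: h1|exact: h2].
move=> /nbhs_ballP[r /= r0 rP].
apply: (null_no_interior cK HK r0) => x /rP[Ox xP]; apply: contrapT => Kx.
have [Wx wx] := xP (U_SF x (conj Ox Kx)).
by move: Wx; rewrite /W (eq_off_K x)// subrr eqxx.
Unshelve. all: by end_near. Qed.
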